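(* Let $0<p<1$ and let $N$ be a positive integer. Then the polynomial $K_{N+3}(x;p,N)$ (in the variable $x$) has at least $N+1$ real zeros $x=0,1,\dots,N$. Furthermore, the remaining two zeros (that is, the two zeros of the quadratic polynomial obtained by dividing $K_{N+3}(x;p,N)$ by $x(x-1)\cdots(x-N)$) are real and distinct when $$0<p<\frac12\left(1-\sqrt{\frac{N+2}{N+3}}\right)\quad\text{or}\quad \frac12\left(1+\sqrt{\frac{N+2}{N+3}}\right)<p<1.$$
   Context: The Pochhammer symbol is $(\alpha)_0=1$ and $(\alpha)_m=\alpha(\alpha+1)\cdots(\alpha+m-1)$ for $m\ge 1$. For $n\in\{0,1,2,\dots\}$, $a\in\mathbb{R}$ and real $p\neq 0$, the polynomial $K_n(x;p,a)$ of degree $n$ in $x$ is given by $$K_n(x;p,a)=\sum_{k=0}^n\frac{(-n)_k(-x)_k(-a+k)_{n-k}}{k!\,p^k}.$$ *)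

(* Defs.v *)
(* MathComp, with the real numbers of MathComp-Analysis. *)
From mathcomp Require Import all_boot all_order all_algebra.
From mathcomp Require Import reals.
Set Implicit Arguments.
Unset Strict Implicit.
Unset Printing Implicit Defensive.
Import GRing.Theory.
Local Open Scope ring_scope.

Definition pochhammer (A : pzSemiRingType) (alpha : A) (m : nat) : A :=
  \prod_(i < m) (alpha + i%:R).

(* The factor [(-x)_k] is taken in [{poly R}], at [- 'X]; the other factors are
   coefficients. [krawtchoukE] recovers the formula at a point. *)
Definition krawtchouk (R : fieldType) (n : nat) (p a : R) : {poly R} :=
  \sum_(k < n.+1)
    (pochhammer (- n%:R) k * pochhammer (- a + k%:R) (n - k)
       / (k`!%:R * p ^+ k)) *: pochhammer (- 'X) k.

Lemma krawtchoukE (R : fieldType) (n : nat) (p a x : R) :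
  (krawtchouk n p a).[x] =
  \sum_(k < n.+1)
    pochhammer (- n%:R) k * pochhammer (- x) k * pochhammer (- a + k%:R) (n - k)
      / (k`!%:R * p ^+ k).
Proof.
rewrite /krawtchouk horner_sum; apply: eq_bigr => k _.
rewrite hornerZ mulrAC; congr (_ / _).
rewrite [LHS]mulrAC; congr (_ * _ * _).
rewrite /pochhammer horner_prod; apply: eq_bigr => i _.
by rewrite hornerD hornerN hornerX -polyC_natr hornerC.
Qed.

(* [x (x - 1) ... (x - N)], of degree [N + 1]. *)
Definition node_poly (R : nzRingType) (N : nat) : {poly R} :=
  \prod_(j < N.+1) ('X - (j%:R)%:P).

(* Main.v *)
Require Import Defs.
From mathcomp Require Import all_boot all_order all_algebra.
From mathcomp Require Import reals.
From mathcomp Require Import ring lra.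
Import Order.TTheory GRing.Theory Num.Theory.
Local Open Scope ring_scope.

(** Write [m = N + 3] and expand [K_m(x; p, N)] along the falling factorials
    [x (x - 1) ... (x - k + 1)].  The [k]-th coefficient is
    ['C(m, k) * (k - N)_(m - k) / p ^ k], and for [k <= N] the Pochhammer factor
    runs through [0] on its way from [k - N] to [2], so that it vanishes.  Only
    [k = N + 1, N + 2, N + 3] survive, and all three falling factorials contain
    [x (x - 1) ... (x - N)].  With [y = x - (N + 1)] this leaves

      [p ^ m * K = x (x - 1) ... (x - N)
                   * (y (y - 1) + 2 m p y + m (m - 1) p ^ 2)],

    which is [krawtchouk_factorization], where the quadratic appears with its
    square completed.  Its discriminant is [1 - 4 m p (1 - p)], and this is
    positive as soon as [p] lies outside the closed interval centred at [1 / 2]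
    of half-width [sqrt ((m - 1) / m) / 2] ([discriminant_gt0]). *)

(** The falling factorial [x (x - 1) ... (x - k + 1)]; [node_poly R N] is the
    instance [k = N.+1]. *)
Definition falling_poly (R : nzRingType) (k : nat) : {poly R} :=
  \prod_(j < k) ('X - (j%:R)%:P).

Lemma falling_polyS (R : nzRingType) (k : nat) :
  falling_poly R k.+1 = falling_poly R k * ('X - (k%:R)%:P).
Proof. by rewrite /falling_poly big_ord_recr. Qed.

(** The sign [(-1) ^ k] here cancels the one of [pochhammerN_nat], which is why
    the expansion below has no signs. *)
Lemma pochhammerN_X (R : comNzRingType) (k : nat) :
  pochhammer (- 'X : {poly R}) k = (-1) ^+ k * falling_poly R k.
Proof.
elim: k => [|k IHk]; first by rewrite /pochhammer /falling_poly !big_ord0 mulr1.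
rewrite falling_polyS /pochhammer big_ord_recr /= -/(pochhammer _ k) IHk.
by rewrite exprS polyC_natr; ring.
Qed.

(** Valid for all [k], and so it also contains the vanishing of [(-n)_k] for
    [k > n], where [n ^_ k = 0]. *)
Lemma pochhammerN_nat (R : comNzRingType) (n k : nat) :
  pochhammer (- n%:R : R) k = (-1) ^+ k * (n ^_ k)%:R.
Proof.
elim: k => [|k IHk]; first by rewrite /pochhammer big_ord0 mulr1.
rewrite /pochhammer big_ord_recr /= -/(pochhammer _ k) IHk ffactnSr exprS natrM.
have [le_kn|lt_nk] := leqP k n; last by rewrite ffact_small // mulr0 !mul0r mulr0.
by rewrite natrB //; ring.
Qed.

Lemma krawtchouk_falling (R : numFieldType) (n : nat) (p a : R) :
  krawtchouk n p a =
  \sum_(k < n.+1)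
    ('C(n, k)%:R * pochhammer (- a + k%:R) (n - k) / p ^+ k) *: falling_poly R k.
Proof.
rewrite /krawtchouk; apply: eq_bigr => k _.
rewrite pochhammerN_nat pochhammerN_X -bin_ffact natrM.
have -> : (-1) ^+ k * falling_poly R k = (-1) ^+ k *: falling_poly R k.
  by rewrite -mul_polyC rmorphXn rmorphN1.
have k_neq0 : k`!%:R != 0 :> R by rewrite pnatr_eq0 -lt0n fact_gt0.
have sqr_sign : (-1) ^+ k * (-1) ^+ k = 1 :> R by rewrite -expr2 sqrr_sign.
rewrite scalerA invfM; congr (_ *: _); set s := (-1) ^+ k in sqr_sign *.
move: (p ^+ k)^-1 => q.
transitivity (s * s * ('C(n, k)%:R * pochhammer (- a + k%:R) (n - k) * q)).
  by field.
by rewrite sqr_sign mul1r.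
Qed.

(** For [k <= n] the factors [k - n, k - n + 1, ...] of [(k - n)_l] reach [0]
    as soon as there are more than [n - k] of them. *)
Lemma pochhammer_reaches0 (R : comNzRingType) (n k l : nat) :
  (k <= n)%N -> (n - k < l)%N -> pochhammer (- n%:R + k%:R : R) l = 0.
Proof.
move=> le_kn lt_l; rewrite addrC -opprB -natrB // pochhammerN_nat.
by rewrite ffact_small // mulr0.
Qed.

Definition discriminant {R : numFieldType} (m : nat) (p : R) : R :=
  1 - 4 * m%:R * p * (1 - p).

(** The square is completed so that the degree and the two roots, symmetric
    about [m (1 - p) - 3 / 2], can be read off.  In [y = x - (m - 2)] this is
    [y (y - 1) + 2 m p y + m (m - 1) p ^ 2]. *)
Definition remaining_quadratic {R : numFieldType} (m : nat) (p : R) : {poly R} :=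
  ('X - (m%:R * (1 - p) - 3 / 2)%:P) ^+ 2 - (discriminant m p / 4)%:P.

Lemma krawtchouk_factorization {R : numFieldType} (N : nat) {p : R} :
  p != 0 ->
  krawtchouk (N + 3) p N%:R =
  p ^- (N + 3) *: (remaining_quadratic (N + 3) p * node_poly R N).
Proof.
move=> p_neq0; rewrite krawtchouk_falling addn3 3!big_ord_recr /=.
rewrite big1 ?add0r => [|k _]; last first.
  have le_kN : (k <= N)%N by exact: (ltn_ord k).
  rewrite pochhammer_reaches0 ?mulr0 ?mul0r ?scale0r //.
  have lt_N : (N < N.+3)%N by rewrite ltnS -addn2 leq_addr.
  by rewrite ltn_sub2r // (leq_ltn_trans le_kN lt_N).
have -> : (N.+3 - N.+1 = 2)%N by rewrite subSS subSn // subSnn.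
rewrite subSnn subnn.
have poch1 : pochhammer (- N%:R + N.+1%:R : R) 2 = 2.
  by rewrite /pochhammer !big_ord_recr big_ord0 /= -[N.+1]addn1 natrD; ring.
have poch2 : pochhammer (- N%:R + N.+2%:R : R) 1 = 2.
  by rewrite /pochhammer !big_ord_recr big_ord0 /= -[N.+2]addn2 natrD; ring.
rewrite {}poch1 {}poch2 [pochhammer _ 0]big_ord0 binn binSn !mulr1.
have -> : 'C(N.+3, N.+1)%:R * 2 = N.+3%:R * N.+2%:R :> R.
  have -> : 'C(N.+3, N.+1) = 'C(N.+3, 2).
    by rewrite -(@bin_sub _ 2) // !subSS subn0.
  by rewrite -[2]/(2`!%:R) -!natrM bin_ffact ffactnS ffactn1.
rewrite !(falling_polyS _ N.+2) !(falling_polyS _ N.+1).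
rewrite -[node_poly R N]/(falling_poly R N.+1).
rewrite /remaining_quadratic /discriminant.
move: (falling_poly R N.+1) => F; set a : R := N.+1%:R.
have N2E : N.+2%:R = a + 1 :> R by rewrite /a mulrS addrC.
have N3E : N.+3%:R = a + 2 :> R by rewrite /a !mulrS; ring.
(* Expanding first keeps the fractions inside scalars, where [field] applies;
   they cancel before the last step, an identity in [{poly R}]. *)
have Xq (c e : R) : ('X - c%:P) ^+ 2 - e%:P =
    'X ^+ 2 - (2 * c)%:P * 'X + (c ^+ 2 - e)%:P by ring.
have -> : N.+3%:R * N.+2%:R / p ^+ N.+1 =
    p ^- N.+3 * ((a + 2) * (a + 1) * p ^+ 2).
  by rewrite N2E N3E !exprS; field; rewrite p_neq0 expf_neq0.
have -> : N.+3%:R * 2 / p ^+ N.+2 = p ^- N.+3 * ((a + 2) * 2 * p).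
  by rewrite N3E !exprS; field; rewrite p_neq0 expf_neq0.
rewrite div1r N2E N3E -2!(scalerA (p ^- N.+3)) -2!scalerDr Xq; congr (_ *: _).
have -> : 2 * ((a + 2) * (1 - p) - 3 / 2) = 2 * (a + 2) * (1 - p) - 3 by field.
have -> : ((a + 2) * (1 - p) - 3 / 2) ^+ 2
    - (1 - 4 * (a + 2) * p * (1 - p)) / 4
    = (a + 2) * (a + 1) * p ^+ 2 - 2 * (a + 2) * p * a + a * (a + 1) by field.
by rewrite -!mul_polyC; ring.
Qed.

Lemma size_remaining_quadratic (R : numFieldType) (m : nat) (p : R) :
  size (remaining_quadratic m p) = 3%N.
Proof.
rewrite /remaining_quadratic size_polyDl size_exp_XsubC // size_polyN.
by rewrite (leq_ltn_trans (size_polyC_leq1 _)).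
Qed.

Lemma root_remaining_quadratic {R : rcfType} {m : nat} {p : R} (x : R) :
  0 <= discriminant m p ->
  let c := m%:R * (1 - p) - 3 / 2 in
  let d := Num.sqrt (discriminant m p / 4) in
  root (remaining_quadratic m p) x <-> x = c - d \/ x = c + d.
Proof.
move=> disc_ge0 c d.
have e_ge0 : 0 <= discriminant m p / 4 by rewrite divr_ge0 ?ler0n.
rewrite /root /remaining_quadratic !hornerE -(sqr_sqrtr e_ge0) -/d -/c.
rewrite subr_eq0 eqf_sqr !subr_eq [- d + c]addrC [d + c]addrC.
split=> [/orP[]/eqP-> | [] ->]; rewrite ?eqxx ?orbT //; [by right | by left].
Qed.

(** The discriminant is [(m + 1) * ((2 p - 1) ^ 2 - m / (m + 1))], and the
    condition on [p] says that [|2 p - 1| > sqrt (m / (m + 1))]. *)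
Lemma discriminant_gt0 {R : rcfType} {m : nat} {p : R} :
  p < 2^-1 * (1 - Num.sqrt (m%:R / m.+1%:R))
  \/ 2^-1 * (1 + Num.sqrt (m%:R / m.+1%:R)) < p ->
  0 < discriminant m.+1 p.
Proof.
set s := Num.sqrt _ => p_far.
have s_ge0 : 0 <= s by exact: sqrtr_ge0.
have m_gt0 : 0 < m.+1%:R :> R by rewrite ltr0n.
have ss : s ^+ 2 = m%:R / m.+1%:R by rewrite sqr_sqrtr ?divr_ge0 ?ler0n.
have sq_lt : s ^+ 2 < (2 * p - 1) ^+ 2 by case: p_far => ?; nra.
rewrite ss ltr_pdivrMr // in sq_lt.
by rewrite /discriminant; move: sq_lt; rewrite -[m.+1]addn1 natrD; nra.
Qed.

Theorem corollary10 (R : realType) (p : R) (N : nat)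
    (hp : 0 < p < 1) (hN : (0 < N)%N) :
  let K := krawtchouk (N + 3) p N%:R in
  let Q := K %/ node_poly R N in
  [/\ forall j : nat, (j <= N)%N -> root K j%:R,
      node_poly R N %| K,
      size Q = 3%N &
      (p < 2^-1 * (1 - Num.sqrt ((N + 2)%:R / (N + 3)%:R))
       \/ 2^-1 * (1 + Num.sqrt ((N + 2)%:R / (N + 3)%:R)) < p) ->
      exists x1 x2 : R,
        x1 != x2 /\ (forall x : R, root Q x <-> x = x1 \/ x = x2)].
Proof.
move=> K Q; have /andP[p_gt0 _] := hp.
have p_neq0 : p != 0 by rewrite gt_eqF.
have c_neq0 : p ^- (N + 3) != 0 by rewrite invr_eq0 expf_neq0.
have KE := krawtchouk_factorization N p_neq0; rewrite -/K in KE.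
have node_neq0 : node_poly R N != 0.
  by rewrite monic_neq0 // /node_poly monic_prod_XsubC.
have QE : Q = p ^- (N + 3) *: remaining_quadratic (N + 3) p.
  by rewrite /Q KE divpZl mulpK.
have node_dvd : node_poly R N %| K by rewrite KE dvdpZr // dvdp_mull.
split=> //.
- move=> j le_jN; apply: (root_dvdp node_dvd).
  have lt_jN : (j < N.+1)%N by [].
  rewrite /node_poly root_factor_theorem (bigD1 (Ordinal lt_jN)) //=.
  exact: dvdp_mulIl.
- by rewrite QE size_scale // size_remaining_quadratic.
- rewrite addn2 addn3 => /discriminant_gt0 disc_gt0.
  set c : R := N.+3%:R * (1 - p) - 3 / 2.
  set d := Num.sqrt (discriminant N.+3 p / 4).
  have d_gt0 : 0 < d by rewrite sqrtr_gt0 divr_gt0 ?ltr0n.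
  exists (c - d), (c + d); split; first by apply/eqP; lra.
  move=> x; rewrite QE rootZ // addn3.
  exact: root_remaining_quadratic (ltW disc_gt0).
Qed.
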